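(* Let $I=[a,b]\subset\mathbb{R}$, let $\varphi:I\to I$, and let $f:I\to[0,\infty)$ be a $\varphi$-$P$-function. Then: (i) if $\varphi$ is linear, then $f\circ\varphi$ belongs to $P(I)$; (ii) if $f$ is increasing and $\varphi$ is convex, then $f\circ\varphi\in P(I)$.
   Context: A function $f:I\to[0,\infty)$ is a $\varphi$-$P$-function (also called $\varphi$-$P$-convex) if $f(t\varphi(x)+(1-t)\varphi(y))\le f(\varphi(x))+f(\varphi(y))$ for all $x,y\in I$ and $t\in(0,1)$. $P(I)$ is the class of functions $g:I\to[0,\infty)$ with $g(\lambda x+(1-\lambda)y)\le g(x)+g(y)$ for all $x,y\in I$ and $\lambda\in[0,1]$. ''$\varphi$ is linear'' means $\varphi(\lambda x+(1-\lambda)y)=\lambda\varphi(x)+(1-\lambda)\varphi(y)$ for all $x,y\in I$, $\lambda\in[0,1]$. ''Increasing'' means $u\le v$ implies $f(u)\le f(v)$. *)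

(* Defs.v *)
From mathcomp Require Import all_boot all_order all_algebra.
From mathcomp Require Import all_classical all_reals all_analysis.

Set Implicit Arguments.
Unset Strict Implicit.
Unset Printing Implicit Defensive.

Import Order.TTheory GRing.Theory Num.Theory.

Local Open Scope classical_set_scope.
Local Open Scope ring_scope.

(* A map I -> J between subsets of the line is a total function R -> R
   satisfying [set_fun I J]; when I is an interval, as is intended below, its
   values outside I are never used. *)

Definition phi_P_function (R : realType) (I : set R) (phi f : R -> R) : Prop :=
  set_fun I `[0, +oo[ f /\
  forall x y t : R, I x -> I y -> 0 < t < 1 ->
    f (t * phi x + (1 - t) * phi y) <= f (phi x) + f (phi y).

Definition class_P (R : realType) (I : set R) : set (R -> R) :=
  [set g | set_fun I `[0, +oo[ g /\
    forall x y l : R, I x -> I y -> 0 <= l <= 1 ->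
      g (l * x + (1 - l) * y) <= g x + g y].

(* Preservation of convex combinations, i.e. an affine map: neither phi 0 = 0
   nor homogeneity is required, so this is not [{linear _ -> _}]. *)
Definition linear_on (R : realType) (I : set R) (phi : R -> R) : Prop :=
  forall x y l : R, I x -> I y -> 0 <= l <= 1 ->
    phi (l * x + (1 - l) * y) = l * phi x + (1 - l) * phi y.

(* Main.v *)
Require Import Defs.
From mathcomp Require Import all_boot all_order all_algebra.
From mathcomp Require Import all_classical all_reals all_analysis.
From mathcomp Require Import lra.

Import Order.TTheory GRing.Theory Num.Theory.
Local Open Scope classical_set_scope.
Local Open Scope ring_scope.

(** The hypothesis bounds [f] at [l * phi x + (1 - l) * phi y], while the goal concerns [f] at
    [phi (l * x + (1 - l) * y)]. If [phi] is linear the two points coincide; if [phi] is convex the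
    second lies below the first, and an increasing [f] preserves this order. [phi_P_function_closed]
    bridges the gap between weights in the open and the closed unit interval. *)

Lemma conv_itvcc (R : realFieldType) (a b x y l : R) :
  x \in `[a, b] -> y \in `[a, b] -> 0 <= l <= 1 ->
  l * x + (1 - l) * y \in `[a, b].
Proof. by rewrite !in_itv /=; nra. Qed.

(* Nonnegativity of f supplies the endpoints l = 0 and l = 1. *)
Lemma phi_P_function_closed (R : realType) (I : set R) (phi f : R -> R) :
  set_fun I I phi -> phi_P_function I phi f ->
  forall x y l : R, I x -> I y -> 0 <= l <= 1 ->
    f (l * phi x + (1 - l) * phi y) <= f (phi x) + f (phi y).
Proof.
move=> phiI [f_ge0 fP] x y l Ix Iy /andP[l0 l1].
have fphi_ge0 z : I z -> 0 <= f (phi z).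
  by move=> /phiI/f_ge0 /=; rewrite in_itv /= andbT.
have [->|ln0] := eqVneq l 0; first
  by rewrite mul0r subr0 mul1r add0r lerDr fphi_ge0.
have [->|ln1] := eqVneq l 1; first
  by rewrite subrr mul0r mul1r addr0 lerDl fphi_ge0.
by apply: fP => //; rewrite !lt_neqAle eq_sym ln0 l0 ln1 l1.
Qed.

Theorem theorem5 (R : realType) (a b : R) (phi f : R -> R)
    (phiI : set_fun `[a, b] `[a, b] phi)
    (fP : phi_P_function `[a, b] phi f) :
  (linear_on `[a, b] phi -> class_P `[a, b] (f \o phi)) /\
  ({in `[a, b] &, {homo f : u v / u <= v}} ->
   @convex_function R R^o `[a, b] phi ->
   class_P `[a, b] (f \o phi)).
Proof.
have f_ge0 : set_fun `[a, b] `[0, +oo[ (f \o phi).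
  by move=> x /phiI; exact: fP.1.
have fP01 := @phi_P_function_closed R _ phi f phiI fP.
split=> [phi_lin|f_incr phi_cvx]; split=> // x y l xI yI l01 /=.
  by rewrite phi_lin//; exact: fP01.
apply: (le_trans _ (fP01 x y l xI yI l01)).
apply: f_incr.
(* Monotonicity of [f] holds only on [[a, b]], so both points must be placed there. *)
- by apply: phiI; exact: conv_itvcc.
- by apply: conv_itvcc => //; exact: phiI.
have /andP[l0 l1] := l01.
(* With [l] packed as a weight, the abstract convex combinations on [R^o] unfold to the ones in the
   goal. *)
exact: (phi_cvx (Itv01 l0 l1) x y (mem_set xI) (mem_set yI)).
Qed.
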